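(* Let $R$ be a Hausdorff linearly topologized ring which is semiperfect and quasi-$\pi$-regular, and let $R_0$ be a T-semi-invariant subring of $R$. Then $R_0$ is semiperfect and quasi-$\pi$-regular (with respect to the induced topology), and there is $n\in\mathbb{N}$ such that $\mathrm{Jac}(R_0)^n\subseteq\mathrm{Jac}(R)$.
   Context: All rings are unital, ring homomorphisms preserve the unity, and subrings share the unity of the ambient ring. A topological ring is linearly topologized (LT) if it has a basis of neighborhoods of $0$ consisting of two-sided ideals. Subrings of topological rings carry the induced topology. A subring $R_0$ of a Hausdorff LT ring $R$ is T-semi-invariant if there is a Hausdorff LT ring $S$ containing $R$ as a topological subring and a set $\Sigma$ of continuous ring endomorphisms of $S$ such that $R_0=\{r\in R:\sigma(r)=r\ \text{for all }\sigma\in\Sigma\}$. An element $a$ of a Hausdorff LT ring $R$ is quasi-$\pi$-regular if there is an idempotent $e\in R$ such that, with $f:=1-e$: (A) $a=eae+faf$; (B) $eae$ is invertible in $eRe$; (C$'$) $(faf)^n\to 0$ as $n\to\infty$ in the topology of $R$. $R$ is quasi-$\pi$-regular if all its elements are. A ring is semiperfect if $R/\mathrm{Jac}(R)$ is semisimple artinian and idempotents lift modulo the Jacobson radical $\mathrm{Jac}(R)$. *)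

(* Defs.v *)
From HB Require Import structures.
From mathcomp Require Import all_boot all_order all_algebra.
From mathcomp Require Import generic_quotient ring_quotient.
From mathcomp Require Import boolp classical_sets functions topology tvs.

Set Implicit Arguments.
Unset Strict Implicit.
Unset Printing Implicit Defensive.

Import GRing.Theory.
Local Open Scope classical_set_scope.
Local Open Scope ring_scope.
Local Open Scope quotient_scope.

(** Rings are [pzRingType]s: unital, not necessarily commutative, and possibly
    zero. *)

Section Ideals.
Variable A : pzRingType.
Implicit Types (I J M : set A).

Definition left_ideal I : Prop :=
  [/\ I 0, forall x y, I x -> I y -> I (x + y) & forall a x, I x -> I (a * x)].

Definition two_sided_ideal I : Prop :=
  left_ideal I /\ forall a x, I x -> I (x * a).

Definition maximal_left_ideal M : Prop :=
  [/\ left_ideal M, M <> setT &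
      forall I, left_ideal I -> M `<=` I -> I = M \/ I = setT].

Definition jacobson : set A :=
  [set x | forall M, maximal_left_ideal M -> M x].

Definition ideal_mul I J : set A :=
  [set z | exists (m : nat) (x y : 'I_m -> A),
     (forall i, I (x i) /\ J (y i)) /\ z = \sum_(i < m) x i * y i].

Definition ideal_exp I (n : nat) : set A := iter n (ideal_mul I) setT.

(** The regular left module of [A] is a semisimple module. *)
Definition semisimple_ring : Prop :=
  forall I, left_ideal I -> exists J,
    [/\ left_ideal J, I `&` J = [set 0] &
        forall a : A, exists x y, [/\ I x, J y & a = x + y]].

Definition artinian_ring : Prop :=
  forall I : nat -> set A,
    (forall n, left_ideal (I n)) -> (forall n, I n.+1 `<=` I n) ->
    exists N, forall n, (N <= n)%N -> I n = I N.

Lemma left_idealN I x : left_ideal I -> I x -> I (- x).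
Proof. by move=> [_ _ IM] Ix; rewrite -mulN1r; apply: IM. Qed.

Lemma jacobson_left_ideal : left_ideal jacobson.
Proof.
split=> [M [[]]//|x y jx jy M mM|a x jx M mM].
- by have [[_ MD _] _ _] := mM; apply: MD; [apply: jx|apply: jy].
- by have [[_ _ MM] _ _] := mM; apply: MM; apply: jx.
Qed.

(* For a maximal left ideal M, {y | y * a \in M} is the whole ring or again
   a maximal left ideal. *)
Lemma jacobson_two_sided_ideal : two_sided_ideal jacobson.
Proof.
split=> [|a x jx M mM]; first exact: jacobson_left_ideal.
have [lM MT Mmax] := mM; have [M0 MD MM] := lM.
have [Ma|Ma] := pselect (M a); first exact: MM.
pose N : set A := [set y | M (y * a)].
have lN : left_ideal N.
  split=> [|y z Ny Nz|b y Ny]; rewrite /N /=.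
  - by rewrite mul0r.
  - by rewrite mulrDl; apply: MD.
  - by rewrite -mulrA; apply: MM.
suff : maximal_left_ideal N by move=> /jx.
split=> // [NT|I lI NI].
  by apply: Ma; have : N 1 by [rewrite NT]; rewrite /N /= mul1r.
have [IN|/existsNP[y /not_implyP[Iy Ny]]] := pselect (I `<=` N).
  by left; apply/seteqP.
right; have [I0 ID IM] := lI.
pose K : set A := [set z | exists m b, [/\ M m, I b & z = m + b * a]].
have lK : left_ideal K.
  split=> [|z z' [m [b [Mm Ib ->]]] [m' [b' [Mm' Ib' ->]]]
           |c z [m [b [Mm Ib ->]]]].
  - by exists 0, 0; rewrite mul0r addr0.
  - exists (m + m'), (b + b'); split; [exact: MD|exact: ID|].
    by rewrite mulrDl addrACA.
  - exists (c * m), (c * b); split; [exact: MM|exact: IM|].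
    by rewrite mulrDr mulrA.
have MK : M `<=` K by move=> m Mm; exists m, 0; rewrite mul0r addr0.
have Kya : K (y * a) by exists 0, y; rewrite add0r.
have [KM|KT] := Mmax _ lK MK; first by case: Ny; rewrite /N /= -KM.
have IT z : I z.
  have [m [b [Mm Ib zaE]]] : K (z * a) by rewrite KT.
  rewrite -[z](subrK b); apply: ID => //; apply: NI.
  by rewrite /N /= mulrBl zaE addrK.
by apply/seteqP; split=> // z _; apply: IT.
Qed.

End Ideals.
Arguments jacobson A : clear implicits.
Arguments semisimple_ring A : clear implicits.
Arguments artinian_ring A : clear implicits.

Definition jac_pred (A : pzRingType) : {pred A} := fun x => x \in jacobson A.
Arguments jac_pred A : clear implicits.

Section JacobsonQuotient.
Variable A : pzRingType.

Lemma jac_predP x : reflect (jacobson A x) (x \in jac_pred A).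
Proof. by apply: (iffP idP) => [/set_mem|/mem_set]. Qed.

Lemma jac_zmod_closed : zmod_closed (jac_pred A).
Proof.
have [J0 JD _] := jacobson_left_ideal A.
split=> [|x y /jac_predP jx /jac_predP jy]; first exact/jac_predP.
apply/jac_predP; apply: JD => //.
exact: left_idealN (jacobson_left_ideal A) jy.
Qed.

HB.instance Definition _ :=
  GRing.isZmodClosed.Build A (jac_pred A) jac_zmod_closed.

(** The ring [A / Jac(A)] and the canonical projection onto it. *)
Definition jac_quot : Type := Quotient.quot (jac_pred A).
HB.instance Definition _ := GRing.Zmodule.on jac_quot.
HB.instance Definition _ : EqQuotient A (Quotient.equiv (jac_pred A)) jac_quot
  := EqQuotient.on jac_quot.

Definition jac_proj (x : A) : jac_quot := \pi_jac_quot x.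

Lemma jac_projP (x y : A) : jac_proj x = jac_proj y <-> jacobson A (x - y).
Proof.
split=> [/eqP|/jac_predP].
- by rewrite -Quotient.idealrBE => /jac_predP.
- by move=> xy; apply/eqP; rewrite -Quotient.idealrBE.
Qed.

Lemma jac_proj_repr (u : jac_quot) : jac_proj (repr u) = u.
Proof. exact: reprK. Qed.

Let one : jac_quot := jac_proj 1.
Let mul (u v : jac_quot) : jac_quot := jac_proj (repr u * repr v).

Let projD (x y : A) : jac_proj (x + y) = jac_proj x + jac_proj y.
Proof. exact: Quotient.pi_add. Qed.

Let projM (x y : A) : jac_proj (x * y) = mul (jac_proj x) (jac_proj y).
Proof.
have [[_ JD JM] JMr] := jacobson_two_sided_ideal A.
apply/jac_projP.
set x' := repr _; set y' := repr _.
have jx : jacobson A (x - x') by apply/jac_projP; rewrite jac_proj_repr.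
have jy : jacobson A (y - y') by apply/jac_projP; rewrite jac_proj_repr.
have -> : x * y - x' * y' = (x - x') * y + x' * (y - y').
  by rewrite mulrBl mulrBr addrA subrK.
by apply: JD; [apply: JMr|apply: JM].
Qed.

Let mulA : associative mul.
Proof.
move=> u v w; rewrite -[u]jac_proj_repr -[v]jac_proj_repr -[w]jac_proj_repr.
by rewrite -!projM mulrA.
Qed.
Let mul1l : left_id one mul.
Proof. by move=> u; rewrite -[u]jac_proj_repr -projM mul1r. Qed.
Let mul1r : right_id one mul.
Proof. by move=> u; rewrite -[u]jac_proj_repr -projM mulr1. Qed.
Let mulDl : left_distributive mul +%R.
Proof.
move=> u v w; rewrite -[u]jac_proj_repr -[v]jac_proj_repr -[w]jac_proj_repr.
by rewrite -projD -!projM -projD mulrDl.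
Qed.
Let mulDr : right_distributive mul +%R.
Proof.
move=> u v w; rewrite -[u]jac_proj_repr -[v]jac_proj_repr -[w]jac_proj_repr.
by rewrite -projD -!projM -projD mulrDr.
Qed.

HB.instance Definition _ :=
  GRing.Zmodule_isPzRing.Build jac_quot mulA mul1l mul1r mulDl mulDr.

Let proj_is_zmod_morphism : zmod_morphism jac_proj.
Proof. by move=> x y; have := projD (x - y) y; rewrite subrK => ->; rewrite addrK. Qed.
Let proj_is_monoid_morphism : monoid_morphism jac_proj.
Proof. by split=> // x y; apply: projM. Qed.

HB.instance Definition _ :=
  GRing.isZmodMorphism.Build A jac_quot jac_proj proj_is_zmod_morphism.
HB.instance Definition _ :=
  GRing.isMonoidMorphism.Build A jac_quot jac_proj proj_is_monoid_morphism.

End JacobsonQuotient.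

Definition semiperfect (A : pzRingType) : Prop :=
  [/\ semisimple_ring (jac_quot A), artinian_ring (jac_quot A) &
      forall u : jac_quot A, u * u = u ->
        exists e : A, e * e = e /\ jac_proj e = u].

HB.mixin Record isTopologicalPzRing R & TopologicalZmodule R & GRing.PzRing R
  := { mul_continuous : continuous (fun x : R * R => x.1 * x.2) }.

#[short(type="topologicalPzRingType")]
HB.structure Definition TopologicalPzRing :=
  { R of TopologicalZmodule R & GRing.PzRing R & isTopologicalPzRing R }.

Definition linearly_topologized (R : topologicalPzRingType) : Prop :=
  forall U : set R, nbhs 0 U ->
    exists I : set R, [/\ two_sided_ideal I, nbhs 0 I & I `<=` U].

Definition topological_embedding (X Y : topologicalType) (f : X -> Y) : Prop :=
  injective f /\
  forall U : set X, open U <-> exists2 V : set Y, open V & U = f @^-1` V.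

Section Subring.
Variables (R : topologicalPzRingType) (R0 : subringClosed R).

(** The subring [R0] of [R] as a ring, with the induced topology. *)
Definition subring_of : Type := {x : R | x \in R0}.

HB.instance Definition _ := SubChoice.on subring_of.
HB.instance Definition _ :=
  GRing.SubChoice_isSubPzRing.Build R _ subring_of (subringClosedP R0).
HB.instance Definition _ :=
  Topological.copy subring_of (initial_topology (val : subring_of -> R)).

Lemma subring_val_continuous : continuous (val : subring_of -> R).
Proof. exact: initial_continuous. Qed.

Lemma subring_continuous (X : topologicalType) (f : X -> subring_of) :
  continuous (val \o f) -> continuous f.
Proof.
move=> /continuousP cf; apply/continuousP => _ [V oV <-].
exact: cf.
Qed.

Let val_pair (z : subring_of * subring_of) : R * R := (val z.1, val z.2).

Let val_pair_continuous : continuous val_pair.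
Proof.
move=> z; apply: cvg_pair => /=.
- by apply: (cvg_comp _ _ cvg_fst); apply: subring_val_continuous.
- by apply: (cvg_comp _ _ cvg_snd); apply: subring_val_continuous.
Qed.

Let subring_sub_continuous :
  continuous (fun z : subring_of * subring_of => z.1 - z.2).
Proof.
apply: subring_continuous.
rewrite (_ : _ \o _ = (fun z : R * R => z.1 - z.2) \o val_pair).
  by move=> z; apply: continuous_comp;
    [exact: val_pair_continuous|exact: sub_continuous].
by apply/funext => z; apply: (rmorphB (val : subring_of -> R)).
Qed.

HB.instance Definition _ :=
  PreTopologicalNmodule_isTopologicalZmodule.Build subring_of
    subring_sub_continuous.

Let subring_mul_continuous :
  continuous (fun z : subring_of * subring_of => z.1 * z.2).
Proof.
apply: subring_continuous.
rewrite (_ : _ \o _ = (fun z : R * R => z.1 * z.2) \o val_pair).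
  by move=> z; apply: continuous_comp;
    [exact: val_pair_continuous|exact: mul_continuous].
by apply/funext => z; apply: (rmorphM (val : subring_of -> R)).
Qed.

HB.instance Definition _ :=
  isTopologicalPzRing.Build subring_of subring_mul_continuous.

End Subring.

(** "[S] contains [R] as a topological subring" is expressed by a ring
    homomorphism [iota : R -> S] that is a topological embedding. *)
Definition T_semi_invariant (R : topologicalPzRingType) (R0 : {pred R}) : Prop :=
  exists (S : topologicalPzRingType) (iota : {rmorphism R -> S})
         (Sigma : set {rmorphism S -> S}),
    [/\ hausdorff_space S, linearly_topologized S, topological_embedding iota,
        forall sigma, Sigma sigma -> continuous sigma &
        forall r : R, r \in R0 <->
          forall sigma, Sigma sigma -> sigma (iota r) = iota r].

Definition quasi_pi_regular_elt (R : topologicalPzRingType) (a : R) : Prop :=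
  exists e : R, let f := 1 - e in
    [/\ e * e = e,
        a = e * a * e + f * a * f,
        (* a unit of the corner ring [eRe], whose unity is [e] *)
        exists b : R, (e * a * e) * (e * b * e) = e /\
                      (e * b * e) * (e * a * e) = e &
        (fun n : nat => (f * a * f) ^+ n) @ \oo --> (0 : R)].

Definition quasi_pi_regular (R : topologicalPzRingType) : Prop :=
  forall a : R, quasi_pi_regular_elt a.

(* Main.v *)
Require Import Defs.
From HB Require Import structures.
From mathcomp Require Import all_boot all_order all_algebra.
From mathcomp Require Import boolp classical_sets functions topology tvs.

(** For [a] in [R] with idempotent [e], the inverse [b] of [eae] in [eRe] is a
    topological Drazin inverse of [a], and such inverses are unique in any
    Hausdorff LT ring: if [e'] comes from another one, then
    [(1-e')e = ((1-e')a)^n b^n e] tends to [0]. So the endomorphisms defining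
    [R0] fix [b], and [R0] is quasi-pi-regular. In a Hausdorff LT
    quasi-pi-regular ring, an element that is left invertible modulo every open
    ideal is invertible; hence the Jacobson radical is closed, idempotents lift
    modulo it, and every left ideal not inside it contains a nonzero
    idempotent.
    Together with the minimal condition on idempotents, which [R0] inherits from
    [R], this makes [R0] semiperfect. Finally [Jac(R)] is open since [R/Jac(R)]
    is artinian, so [Jac(R0)] maps to a nil subring of [R/Jac(R)], which is
    nilpotent by Levitzki's theorem. *)

Set Implicit Arguments.
Unset Strict Implicit.
Unset Printing Implicit Defensive.

Import GRing.Theory.
Local Open Scope classical_set_scope.
Local Open Scope ring_scope.

(** * Maximal left ideals, the Jacobson radical and nil subsemigroups *)

Section LeftIdeals.
Variable A : pzRingType.
Implicit Types I M N P X : set A.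

Lemma left_idealT I : left_ideal I -> I 1 -> I = setT.
Proof.
by move=> [_ _ IM] I1; apply/seteqP; split=> // x _;
  rewrite -[x]mulr1; apply: IM.
Qed.

Lemma left_ideal_preim_mulr I a :
  left_ideal I -> left_ideal [set x | I (x * a)].
Proof.
move=> [I0 ID IM]; split=> [|x y Ix Iy|b x Ix] /=.
- by rewrite mul0r.
- by rewrite mulrDl; apply: ID.
- by rewrite -mulrA; apply: IM.
Qed.

Lemma left_ideal_imager I a : left_ideal I -> left_ideal [set x * a | x in I].
Proof.
move=> [I0 ID IM]; split=> [|_ _ [x Ix <-] [y Iy <-]|b _ [x Ix <-]] /=.
- by exists 0; rewrite ?mul0r.
- by exists (x + y); [apply: ID|rewrite mulrDl].
- by exists (b * x); [apply: IM|rewrite mulrA].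
Qed.

Definition left_span X : set A :=
  [set x | forall I, left_ideal I -> X `<=` I -> I x].

Lemma left_span_left_ideal X : left_ideal (left_span X).
Proof.
split=> [I [] //|x y sx sy I lI XI|a x sx I lI XI].
- by case: (lI) => _ ID _; apply: ID; [apply: sx|apply: sy].
- by case: (lI) => _ _ IM; apply: IM; apply: sx.
Qed.

Lemma sub_left_span X : X `<=` left_span X.
Proof. by move=> x Xx I _; apply. Qed.

Lemma left_span_sub X I : left_ideal I -> X `<=` I -> left_span X `<=` I.
Proof. by move=> lI XI x; apply. Qed.

Lemma maximal_left_ideal_exists I : left_ideal I -> ~ I 1 ->
  exists2 M, maximal_left_ideal M & I `<=` M.
Proof.
move=> lI I1.
(* The guard [X !=set0] lets the empty set satisfy [P], as the union of the empty chain must. *)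
pose P (X : set A) := X !=set0 -> [/\ left_ideal X, I `<=` X & ~ X 1].
have [F FP Ftot|M [MP Mmax]] := @Zorn_bigcup _ P.
  move=> [x0 [X0 FX0 X0x0]].
  have {x0 X0x0} [lX0 IX0 _] : [/\ left_ideal X0, I `<=` X0 & ~ X0 1].
    by apply: (FP _ FX0); exists x0.
  have FI X x : F X -> X x -> [/\ left_ideal X, I `<=` X & ~ X 1].
    by move=> FX Xx; apply: (FP _ FX); exists x.
  split=> [|x Ix|[X FX X1]]; last by have [] := FI X 1 FX X1.
    split=> [|x y [X FX Xx] [Y FY Yy]|a x [X FX Xx]].
    - by exists X0 => //; case: lX0.
    - have [[_ XD _] _ _] := FI _ _ FX Xx; have [[_ YD _] _ _] := FI _ _ FY Yy.
      by have [XY|YX] := Ftot _ _ FX FY;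
        [exists Y => //; apply: YD => //; apply: XY
        |exists X => //; apply: XD => //; apply: YX].
    - by exists X => //; have [[_ _ XM] _ _] := FI _ _ FX Xx; apply: XM.
  by exists X0 => //; apply: IX0.
have maxM K : M `<=` K -> P K -> K = M.
  move=> MK PK; apply/seteqP; split=> //; apply: contrapT => KM.
  by apply: (Mmax K) => //; split.
have PI : P I by move=> _; split.
have M0 : M !=set0.
  apply: contrapT => nM; have M0 : M = set0 by apply/eqP/negPn/negP => /set0P.
  have IM : I = M by apply: maxM => //; rewrite M0.
  by case: lI => I0 _ _; rewrite IM M0 in I0.
have [lM IM M1] := MP M0.
exists M => //; split=> // [MT|K lK MK]; first by apply: M1; rewrite MT.
have [K1|K1] := pselect (K 1); first by right; apply: left_idealT.
by left; apply: maxM => // _; split=> //; apply: subset_trans MK.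
Qed.

Lemma jacobson_left_inv x : jacobson A x -> exists y, y * (1 - x) = 1.
Proof.
move=> jx; apply: contrapT => noinv.
have l0 : left_ideal [set y * (1 - x) | y in setT].
  by apply: left_ideal_imager; split.
have [[y _ yx]|M mM IM] := maximal_left_ideal_exists l0.
  by apply: noinv; exists y.
have [lM MT _] := mM; apply: MT; apply: left_idealT => //.
rewrite -(subrK x 1); case: (lM) => _ MD _; apply: MD; last exact: jx.
by apply: IM; exists 1; rewrite ?mul1r.
Qed.

(** If a maximal [M] misses [x], then [M + A * x] is everything, so some [1 - r * x] lies in [M],
    and its left inverse puts [1] in [M]. *)
Lemma left_inv_jacobson x :
  (forall r, exists y, y * (1 - r * x) = 1) -> jacobson A x.
Proof.
move=> xinv M mM; apply: contrapT => Mx.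
have [lM MT maxM] := mM; have [M0 MD MM] := lM.
pose K : set A := [set z | exists m r, M m /\ z = m + r * x].
have lK : left_ideal K.
  split=> [|_ _ [m [r [Mm ->]]] [m' [r' [Mm' ->]]]|a _ [m [r [Mm ->]]]].
  - by exists 0, 0; rewrite mul0r addr0.
  - by exists (m + m'), (r + r'); split; [exact: MD|rewrite mulrDl addrACA].
  - by exists (a * m), (a * r); split; [exact: MM|rewrite mulrDr mulrA].
have [|KM|KT] := maxM _ lK.
- by move=> m Mm; exists m, 0; rewrite mul0r addr0.
  by apply: Mx; rewrite -KM; exists 0, 1; rewrite add0r mul1r.
have [m [r [Mm e1]]] : K 1 by rewrite KT.
apply: MT; apply: left_idealT => //.
have [y <-] := xinv r; apply: MM.
by rewrite [X in X - _]e1 addrK.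
Qed.

Lemma idempotent_jacobson_eq0 e : e * e = e -> jacobson A e -> e = 0.
Proof.
move=> ee /jacobson_left_inv[y y1].
by rewrite -[LHS]mul1r -y1 -mulrA mulrBl mul1r ee subrr mulr0.
Qed.

Lemma artinian_min : artinian_ring A ->
  forall F : set (set A), F !=set0 -> (forall I, F I -> left_ideal I) ->
  exists2 I, F I & forall K, F K -> K `<=` I -> K = I.
Proof.
move=> artA F [I0 FI0] Fl; apply: contrapT => nomin.
have /choice[f fP] : forall I, exists K, F I -> [/\ F K, K `<=` I & K <> I].
  move=> I; have [FI|nFI] := pselect (F I); last by exists I.
  apply: contrapT => noK; apply: nomin; exists I => // K FK KI.
  by apply: contrapT => KnI; apply: noK; exists K.
have FI n : F (iter n f I0) by elim: n => //= n /fP[].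
have [n|n|n nP] := artA (fun n => iter n f I0).
- exact: Fl.
- by have [] := fP _ (FI n).
- by have [_ _] := fP _ (FI n); apply; apply: (nP n.+1).
Qed.

(* [kill N j x] says that [x * n_1 * ... * n_j = 0] for all [n_i] in [N]. *)
Fixpoint kill N (j : nat) (x : A) : Prop :=
  if j is j'.+1 then forall n, N n -> kill N j' (x * n) else x = 0.

Lemma kill_left_ideal N j : left_ideal (kill N j).
Proof.
elim: j => [|j [IH0 IHD IHM]] /=.
  split=> [//|x y -> ->|a x ->]; by rewrite ?addr0 ?mulr0.
split=> [n Nn|x y kx ky n Nn|a x kx n Nn].
- by rewrite mul0r.
- by rewrite mulrDl; apply: IHD; [apply: kx|apply: ky].
- by rewrite -mulrA; apply: IHM; apply: kx.
Qed.

Lemma kill_mono N i j x : (i <= j)%N -> kill N i x -> kill N j x.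
Proof.
elim: i j x => [|i IH] [|j] x //=; last by move=> ij kx n /kx; apply: IH.
by move=> _ -> n _; case: (kill_left_ideal N j) => k0 _ _; rewrite mul0r.
Qed.

(* Levitzki's theorem: if [L] is minimal among the right [N]-stable left ideals
   on which [N] is not nilpotent, and [P] is its largest [N]-stable proper
   subideal, an [a] in [N] with [L * a] minimal not below [P] satisfies
   [L * a * N <= P] and [L * a * a <= P]; so the stable ideal
   [L * a + L * a * N] is [L], hence [L * a <= P], a contradiction. *)
Lemma nil_subsemigroup_nilpotent N :
  artinian_ring A -> semisimple_ring A ->
  (forall x y, N x -> N y -> N (x * y)) ->
  (forall x, N x -> exists k, x ^+ k = 0) ->
  exists j, forall x, kill N j x.
Proof.
move=> artA ssA NM Nnil; apply: contrapT => nonil.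
pose stable I := forall x n, I x -> N n -> I (x * n).
pose F := [set I | [/\ left_ideal I, stable I & forall j, ~ I `<=` kill N j]].
have stable_span X : (forall x n, X x -> N n -> left_span X (x * n)) ->
    stable (left_span X).
  move=> XN x n sx Nn.
  apply: (sx [set y | left_span X (y * n)]) => [|y Xy /=]; last exact: XN.
  exact: left_ideal_preim_mulr (left_span_left_ideal X).
have [||L [lL stL Lnk] minL] := artinian_min artA (F := F).
- exists setT; split=> [|//|j Tk]; first by split.
  by apply: nonil; exists j => x; apply: Tk.
- by move=> I [].
pose P := [set x | exists j, kill N j x].
have lP : left_ideal P.
  split=> [|x y [i kx] [j ky]|a x [j kx]].
  - by exists 0%N.
  - exists (i + j)%N; case: (kill_left_ideal N (i + j)) => _ kD _.
    by apply: kD; [apply: kill_mono kx; apply: leq_addr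
                  |apply: kill_mono ky; apply: leq_addl].
  - by exists j; case: (kill_left_ideal N j) => _ _ kM; apply: kM.
have subP I : left_ideal I -> stable I -> I `<=` L -> I = L \/ I `<=` P.
  move=> lI stI IL; have [FI|nFI] := pselect (F I); first by left; apply: minL.
  right; apply: contrapT => nIP; apply: nFI; split=> // j Ij.
  by apply: nIP => x /Ij; exists j.
(* Word lengths in [P] vary with the element. Writing [1 = e + g] along a complement of [L] gives
   [x = x * e] on [L], so a length that kills [e] kills all of [L]. *)
have LnP : ~ L `<=` P.
  move=> LP; have [K [lK LK0 LKT]] := ssA L lL.
  have [e [g [Le Kg eg]]] := LKT 1.
  have [j kj] := LP _ Le; apply: (Lnk j) => x Lx.
  suff -> : x = x * e by case: (kill_left_ideal N j) => _ _ kM; apply: kM.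
  apply/eqP; rewrite -subr_eq0; apply/eqP.
  suff : (L `&` K) (x - x * e) by rewrite LK0.
  have [_ LD LM] := lL; have [_ _ KM] := lK.
  split; first by apply: LD => //; apply: left_idealN => //; apply: LM.
  by rewrite -[X in X - _](mulr1 x) eg mulrDr addrC addKr; apply: KM.
(* If [L * N] were inside [P], the stable left ideal it spans would be either [L], hence inside [P],
   or killed by words of some length [j], so that length [j.+1] kills [L]. *)
have [a0 Na0 La0] : exists2 a, N a & ~ [set x * a | x in L] `<=` P.
  apply: contrapT => noa.
  have LNP x n : L x -> N n -> P (x * n).
    move=> Lx Nn; apply: contrapT => nP; apply: noa; exists n => //.
    by move=> sub; apply/nP/sub; exists x.
  pose X := [set y | exists x n, [/\ L x, N n & y = x * n]].
  have XL : left_span X `<=` L.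
    by apply: left_span_sub => // _ [x [n [Lx Nn ->]]]; apply: stL.
  have stX : stable (left_span X).
    apply: stable_span => _ n [x [m [Lx Nm ->]]] Nn.
    by apply: sub_left_span; exists (x * m), n; split=> //; apply: stL.
  have XP : left_span X `<=` P.
    by apply: left_span_sub => // _ [x [n [Lx Nn ->]]]; apply: LNP.
  have nFX : ~ F (left_span X).
    by move=> FX; apply: LnP; rewrite -(minL _ FX XL).
  apply: nFX; split=> //; first exact: left_span_left_ideal.
  move=> j Xj; apply: (Lnk j.+1) => x Lx n Nn; apply: Xj.
  by apply: sub_left_span; exists x, n.
pose G := [set I | exists2 a, N a & I = [set x * a | x in L] /\ ~ I `<=` P].
have [||_ [a Na [-> LaP]] mina] := artinian_min artA (F := G).
- by exists [set x * a0 | x in L], a0.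
- by move=> I [a _ [-> _]]; apply: left_ideal_imager.
(* The cases [t = 1] and [t] in [N] serve [L * a * a] and [L * a * N * a]. If the claim fails,
   minimality gives [L * a * (t * a) = L * a]; iterating, nilpotency of [t * a] yields
   [L * a = 0]. *)
have LatP t x : N (a * (t * a)) \/ t = 1 -> N (t * a) ->
    (forall y, L y -> L (y * a * t)) -> L x -> P (x * a * (t * a)).
  move=> Nata Nta Lat Lx; apply: contrapT => nP.
  have Nata' : N (a * (t * a)).
    by case: Nata => // t1; rewrite t1 mul1r; apply: NM.
  have LE : [set y * (a * (t * a)) | y in L] = [set y * a | y in L].
    apply: mina; last first.
      move=> _ [y Ly <-]; exists (y * a * t); first exact: Lat.
      by rewrite !mulrA.
    exists (a * (t * a)) => //; split=> // sub; apply: nP.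
    by rewrite -mulrA; apply: sub; exists x.
  have [k tak] := Nnil _ Nta.
  apply: LaP => _ [y Ly <-].
  have {y Ly} [z ->] : exists z, y * a = z * (t * a) ^+ k; last first.
    by rewrite tak mulr0; case: lP.
  suff [z _ ->] : exists2 z, L z & y * a = z * a * (t * a) ^+ k.
    by exists (z * a).
  elim: (k) => [|i [z Lz ->]]; first by exists y; rewrite ?expr0 ?mulr1.
  have [w Lw <-] : [set y * (a * (t * a)) | y in L] (z * a).
    by rewrite LE; exists z.
  by exists w => //; rewrite exprS !mulrA.
pose X := [set y | exists2 x, L x &
  y = x * a \/ exists2 n, N n & y = x * a * n].
have XL : left_span X `<=` L.
  apply: left_span_sub => // _ [x Lx [->|[n Nn ->]]]; first exact: stL.
  by apply: (stL) => //; apply: stL.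
have stX : stable (left_span X).
  apply: stable_span => _ n [x Lx [->|[m Nm ->]]] Nn; apply: sub_left_span.
    by exists x => //; right; exists n.
  by exists x => //; right; exists (m * n); [exact: NM|rewrite mulrA].
have XP : left_span X `<=` [set y | P (y * a)].
  apply: left_span_sub; first exact: left_ideal_preim_mulr.
  move=> _ [x Lx [->|[n Nn ->]]] /=.
    rewrite -[X in _ * X]mul1r; apply: LatP => //; rewrite ?mul1r //.
    - by right.
    - by move=> y Ly; rewrite mulr1; apply: stL.
  rewrite -mulrA; apply: LatP => //.
  - by left; apply: (NM) => //; apply: NM.
  - exact: NM.
  - by move=> y Ly; apply: (stL) => //; apply: stL.
have [XE|XP'] := subP _ (left_span_left_ideal X) stX XL.
  by apply: LaP => _ [x Lx <-]; apply: XP; rewrite XE.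
by apply: LaP => _ [x Lx <-]; apply: XP'; apply: sub_left_span;
  exists x => //; left.
Qed.

End LeftIdeals.

(** * The quotient by the radical and minimal idempotents *)

Section JacobsonQuotient.
Variable A : pzRingType.

Lemma jac_proj0 : jac_proj (0 : A) = 0. Proof. exact: rmorph0. Qed.
Lemma jac_proj1 : jac_proj (1 : A) = 1. Proof. exact: rmorph1. Qed.

Lemma jac_projD (x y : A) : jac_proj (x + y) = jac_proj x + jac_proj y.
Proof. exact: rmorphD. Qed.

Lemma jac_projB (x y : A) : jac_proj (x - y) = jac_proj x - jac_proj y.
Proof. exact: rmorphB. Qed.

Lemma jac_projM (x y : A) : jac_proj (x * y) = jac_proj x * jac_proj y.
Proof. exact: rmorphM. Qed.

Lemma jac_proj_eq0 (x : A) : jac_proj x = 0 <-> jacobson A x.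
Proof. by rewrite -jac_proj0 jac_projP subr0. Qed.

(** The order on idempotents is [g <= e] iff [e * g = g = g * e]. Since only products occur, the
    condition passes to subrings, which the artinian condition need not do. *)
Definition idempotent_min : Prop :=
  forall E : set A, E !=set0 -> (forall e, E e -> e * e = e) ->
  exists2 e, E e & forall g, E g -> e * g = g -> g * e = g -> g = e.

(** Choose [e] whose image generates a minimal left ideal. An idempotent [g] below [e] generates the
    same one, so the idempotent [e - g] lies in the radical and vanishes. *)
Lemma artinian_idempotent_min : artinian_ring (jac_quot A) -> idempotent_min.
Proof.
move=> artA E [e0 Ee0] Eidem.
pose F := [set I | exists2 e, E e & I = [set x * jac_proj e | x in setT]].
have [||_ [e Ee ->] mine] := artinian_min artA (F := F).
- by exists [set x * jac_proj e0 | x in setT], e0.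
- by move=> _ [e _ ->]; apply: left_ideal_imager; split.
exists e => // g Eg eg ge.
have ImE : [set x * jac_proj g | x in setT] = [set x * jac_proj e | x in setT].
  apply: mine; first by exists g.
  move=> _ [x _ <-]; exists (x * jac_proj g) => //.
  by rewrite -mulrA -jac_projM ge.
have [x _ xg] : [set x * jac_proj g | x in setT] (jac_proj e).
  by rewrite ImE; exists 1; rewrite ?mul1r.
have jeg : jacobson A (e - g).
  apply/jac_projP; have <- : jac_proj e * jac_proj g = jac_proj e.
    by rewrite -xg -mulrA -jac_projM Eidem.
  by rewrite -jac_projM eg.
apply/esym/eqP; rewrite -subr_eq0; apply/eqP.
apply: idempotent_jacobson_eq0 jeg.
by rewrite mulrBr !mulrBl (Eidem e) // (Eidem g) // eg ge subrr subr0.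
Qed.

End JacobsonQuotient.
Arguments idempotent_min A : clear implicits.

(** * Open ideals and topological Drazin inverses *)

Definition ideal_separated (A : topologicalPzRingType) : Prop :=
  forall x : A, (forall I, two_sided_ideal I -> nbhs (0 : A) I -> I x) -> x = 0.

Lemma hausdorff_ideal_separated (A : topologicalPzRingType) :
  hausdorff_space A -> linearly_topologized A -> ideal_separated A.
Proof.
move=> hA ltA x xI; apply/esym/hA => U V U0 Vx.
have [I [tI I0 IU]] := ltA _ U0.
by exists x; split; [apply: IU; apply: xI|apply: nbhs_singleton Vx].
Qed.

(* The Drazin inverse of [a], with "nilpotent" weakened to "topologically
   nilpotent"; the idempotent of the decomposition of [a] is [b * a]. *)
Definition drazin_inverse (A : topologicalPzRingType) (a b : A) : Prop :=
  [/\ a * b = b * a, b * a * b = b &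
      (fun n : nat => (a * (1 - b * a)) ^+ n) @ \oo --> (0 : A)].

Lemma idempotentC (A : pzRingType) (e : A) : e * e = e ->
  (1 - e) * (1 - e) = 1 - e.
Proof. by move=> ee; rewrite mulrBr mulr1 mulrBl mul1r ee subrr subr0. Qed.

Lemma commC (A : pzRingType) (a e : A) : a * e = e * a ->
  a * (1 - e) = (1 - e) * a.
Proof. by move=> ae; rewrite mulrBr mulrBl mulr1 mul1r ae. Qed.

(** From [e] one takes the inverse [e * b * e] of [e * a * e] in the corner; from [b], the
    idempotent [b * a]. Either way the idempotent commutes with [a], so [faf = af]. *)
Lemma quasi_pi_regular_eltP (A : topologicalPzRingType) (a : A) :
  quasi_pi_regular_elt a <-> exists b, drazin_inverse a b.
Proof.
split=> [[e [ee aE [b [abe bae]] cv]]|[b [ab bab cv]]].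
  have fe : (1 - e) * e = 0 by rewrite mulrBl mul1r ee subrr.
  have ef : e * (1 - e) = 0 by rewrite mulrBr mulr1 ee subrr.
  have eae : e * a * e = a * e.
    by rewrite [in RHS]aE mulrDl -!mulrA fe !mulr0 addr0 ee.
  have ea : e * (a * e) = e * a.
    by rewrite [in RHS]aE mulrDr !mulrA ef !mul0r addr0 ee.
  have ae : a * e = e * a by rewrite -eae -mulrA.
  have ab : a * (e * b * e) = e.
    by rewrite -[RHS]abe !mulrA -(mulrA _ e e) ee eae.
  have ba : (e * b * e) * a = e.
    by rewrite -[RHS]bae -!mulrA (mulrA e e) ee ea.
  exists (e * b * e); split; rewrite ?ab ?ba //.
    by rewrite !mulrA ee.
  by have <- : (1 - e) * a * (1 - e) = a * (1 - e);
    rewrite // -mulrA (commC ae) mulrA (idempotentC ee).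
set e := b * a.
have ee : e * e = e by rewrite /e mulrA bab.
have ae : a * e = e * a by rewrite /e mulrA ab.
have be : b * e = b by rewrite /e -ab mulrA.
have faf : (1 - e) * a * (1 - e) = a * (1 - e).
  by rewrite -mulrA (commC ae) mulrA (idempotentC ee).
have eae : e * a * e = a * e by rewrite -mulrA ae mulrA ee.
have ebe : e * b * e = b by rewrite /e bab.
exists e; split=> //.
- by rewrite eae faf -mulrDr addrC subrK mulr1.
- exists b; rewrite eae ebe; split; last by rewrite mulrA -/e ee.
  by rewrite -mulrA /e bab ab.
- by rewrite faf.
Qed.

Section IdealSeparated.
Variable A : topologicalPzRingType.
Hypothesis sepA : ideal_separated A.
Implicit Types (a b e u x y : A) (I : set A).

(** The exponent is positive because, for [x] idempotent modulo the radical, [x ^+ n.+1] is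
    congruent to [x] while [x ^+ 0] need not be. *)
Lemma cvg0_exprS_ideal x I : (fun n : nat => x ^+ n) @ \oo --> (0 : A) ->
  nbhs (0 : A) I -> exists n, I (x ^+ n.+1).
Proof. by move=> cx /cx[N _ NI]; exists N; apply: NI => /=. Qed.

(** With [e = b * a] one has [e = a ^+ n * b ^+ n * e]. As [p] commutes with [a],
    [p * e = (a * p) ^+ n * p * b ^+ n * e] for every [n], which lies in any given open ideal for
    large [n]; [e * p] is symmetric. *)
Lemma topnil_idempotent_eq0 a b p : a * b = b * a -> b * a * b = b ->
  a * p = p * a -> p * p = p ->
  (fun n : nat => (a * p) ^+ n) @ \oo --> (0 : A) ->
  p * (b * a) = 0 /\ (b * a) * p = 0.
Proof.
move=> ab bab ap pp cv; set e := b * a.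
have ee : e * e = e by rewrite /e mulrA bab.
have bn n : b ^+ n * e = a * (b ^+ n.+1 * e).
  have -> : a * (b ^+ n.+1 * e) = a * b * (b ^+ n * e) by rewrite exprS !mulrA.
  have -> : b ^+ n * e = e * b ^+ n.
    by apply/esym/commrX; rewrite /GRing.comm /e bab -ab mulrA bab.
  by rewrite ab mulrA ee.
have bn' n : e * b ^+ n = (e * b ^+ n.+1) * a.
  have -> : (e * b ^+ n.+1) * a = e * b ^+ n * (b * a) by rewrite exprSr !mulrA.
  have -> : e * b ^+ n = b ^+ n * e.
    by apply/commrX; rewrite /GRing.comm /e bab -ab mulrA bab.
  by rewrite -mulrA ee.
have pe n : p * e = (a * p) ^+ n * (p * (b ^+ n * e)).
  elim: n => [|n ->]; first by rewrite !expr0 !mul1r.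
  by rewrite exprSr -[RHS]mulrA; congr (_ * _);
    rewrite bn mulrA -ap -{1}pp !mulrA.
have ep n : e * p = (e * b ^+ n) * p * (a * p) ^+ n.
  elim: n => [|n ->]; first by rewrite !expr0 !mulr1.
  rewrite (exprS (a * p)) [RHS]mulrA; congr (_ * _).
  by rewrite bn' -!mulrA; do 2!congr (_ * _);
    rewrite [p * _]mulrA -ap -mulrA pp.
split; apply: sepA => I [[I0 ID IM] IMr] nI;
  have [n In] := cvg0_exprS_ideal cv nI.
- by rewrite (pe n.+1); apply: IMr.
- by rewrite (ep n.+1); apply: IM.
Qed.

Lemma drazin_inverse_uniq a b b' :
  drazin_inverse a b -> drazin_inverse a b' -> b = b'.
Proof.
have aux c c' : drazin_inverse a c -> drazin_inverse a c' ->
    c * a = c' * a * (c * a) /\ c * a = c * a * (c' * a).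
  move=> [ac cac _] [ac' cac' cv'].
  have ae : a * (c' * a) = c' * a * a by rewrite mulrA ac'.
  have ee : c' * a * (c' * a) = c' * a by rewrite mulrA cac'.
  have [pe ep] := topnil_idempotent_eq0 ac cac (commC ae) (idempotentC ee) cv'.
  by split; apply/eqP; rewrite -subr_eq0;
    [rewrite -{1}[c * a]mul1r -mulrBl pe|rewrite -{1}[c * a]mulr1 -mulrBr ep].
move=> db db'; have [e1 _] := aux _ _ db db'; have [_ e2] := aux _ _ db' db.
have {e1 e2} e : b * a = b' * a by rewrite e1 -e2.
case: db db' => [ab bab _] [ab' bab' _].
by rewrite -bab e -mulrA ab e -ab' mulrA bab'.
Qed.

(** If [y * u] is [1] modulo [I], then [f = 1 - b * u] is congruent to [y ^+ n * (u * f) ^+ n * f]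
    for every [n], which is in [I] for large [n]. So [f] is in every open ideal. *)
Lemma left_inv_of_ideals u b : drazin_inverse u b ->
  (forall I, two_sided_ideal I -> nbhs (0 : A) I -> exists y, I (y * u - 1)) ->
  b * u = 1.
Proof.
move=> [ub bub cv] uI; apply/esym/eqP; rewrite -subr_eq0; apply/eqP.
set f := 1 - b * u in cv *.
have ff : f * f = f by apply: idempotentC; rewrite mulrA bub.
have fuf : f * (u * f) = u * f.
  by rewrite mulrA -commC ?mulrA ?ub // -mulrA ff.
clearbody f.
apply: sepA => I [lI IMr] nI; have [I0 ID IM] := lI.
have [|y Iy] := uI I _ nI; first by [].
have Ifn n : I (f - y ^+ n * ((u * f) ^+ n * f)).
  elim: n => [|n IHn]; first by rewrite !expr0 !mul1r subrr.
  rewrite -[X in X - _](subrK (y ^+ n * ((u * f) ^+ n * f))) -addrA.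
  apply: ID => //.
  have fX : (u * f) ^+ n * f = f * ((u * f) ^+ n * f).
    have cf : GRing.comm f (u * f) by rewrite /GRing.comm fuf -mulrA ff.
    by rewrite mulrA (commrX n cf) -mulrA ff.
  have -> : y ^+ n * ((u * f) ^+ n * f) - y ^+ n.+1 * ((u * f) ^+ n.+1 * f) =
     - (y ^+ n * ((y * u - 1) * ((u * f) ^+ n * f))).
    rewrite exprSr exprS mulrBl mul1r mulrBr opprB; congr (_ - _).
    by rewrite [in RHS]fX !mulrA.
  by apply: left_idealN lI _; apply/IM/IMr.
have [n In] := cvg0_exprS_ideal cv nI.
rewrite -[f](subrK (y ^+ n.+1 * ((u * f) ^+ n.+1 * f))).
by apply: ID => //; apply/IM/IMr.
Qed.

(** Modulo an open ideal a finite geometric sum inverts [1 - x]; the Drazin inverse of [1 - x]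
    replaces the limit of these sums. *)
Lemma topnil_left_inv x : (fun n : nat => x ^+ n) @ \oo --> (0 : A) ->
  quasi_pi_regular_elt (1 - x) -> exists z, z * (1 - x) = 1.
Proof.
move=> cx /quasi_pi_regular_eltP[b db]; exists b.
apply: left_inv_of_ideals db _; move=> I [lI _] nI; have [n In] := cvg0_exprS_ideal cx nI.
have [z zx] : exists z, z * (1 - x) = 1 - x ^+ n.+1.
  elim: (n.+1) => [|m [z zx]]; first by exists 0; rewrite expr0 mul0r subrr.
  exists (z + x ^+ m); rewrite mulrDl zx mulrBr mulr1 -exprSr addrA subrK //.
by exists z; rewrite zx addrC addKr; apply: left_idealN.
Qed.

(** * Quasi-pi-regular rings: closed radical, lifting, semiperfectness *)

Hypothesis qprA : quasi_pi_regular A.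

(** Modulo [I], [1 - r * x] agrees with [1 - r * j], which has a left inverse, so
    [left_inv_of_ideals] applies. *)
Lemma jacobson_closed x :
  (forall I, two_sided_ideal I -> nbhs (0 : A) I ->
     exists2 j, jacobson A j & I (x - j)) -> jacobson A x.
Proof.
move=> xI; apply: left_inv_jacobson => r.
have /quasi_pi_regular_eltP[b db] := qprA (1 - r * x).
exists b; apply: left_inv_of_ideals db _ => I tI nI.
have [j jj Ij] := xI I tI nI; have [lI IMr] := tI; have [_ _ IM] := lI.
have [|y y1] := @jacobson_left_inv A (r * j).
  by case: (jacobson_left_ideal A) => _ _ JM; apply: JM.
exists y; have -> : y * (1 - r * x) - 1 = - (y * (r * (x - j))).
  rewrite -[X in _ - X]y1 -mulrBr opprB addrC addrA subrK.
  by rewrite -mulrBr -mulrN -mulrN opprB.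
by apply: left_idealN lI _; apply/IM/IM.
Qed.

(** For a lift [a] of [u] take [e = b * a]. The part [x = a * (1 - e)] is idempotent modulo the
    radical and topologically nilpotent, hence congruent to arbitrarily small powers of itself;
    closedness puts it in the radical. *)
Lemma jac_lift_idempotent (u : jac_quot A) : u * u = u ->
  exists e : A, e * e = e /\ jac_proj e = u.
Proof.
move=> uu; pose a := repr u; have au : jac_proj a = u by apply: jac_proj_repr.
have [lJ JMr] := jacobson_two_sided_ideal A; have [J0 JD JM] := lJ.
have jaa : jacobson A (a * a - a) by apply/jac_projP; rewrite jac_projM au uu.
have /quasi_pi_regular_eltP[b [ab bab cv]] := qprA a.
set e := b * a in cv.
have ee : e * e = e by rewrite /e mulrA bab.
have ae : a * e = e * a by rewrite /e mulrA ab.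
exists e; split=> //; rewrite -au; apply/jac_projP.
set x := a * (1 - e) in cv.
have jxx : jacobson A (x * x - x).
  have -> : x * x - x = (a * a - a) * (1 - e).
    rewrite mulrBl; congr (_ - _).
    rewrite /x {2}(commC ae) mulrA -(mulrA a) (idempotentC ee).
    by rewrite -mulrA -(commC ae) mulrA.
  exact: JMr.
have jxn n : jacobson A (x ^+ n.+1 - x).
  elim: n => [|n IHn]; first by rewrite expr1 subrr.
  have -> : x ^+ n.+2 - x = x ^+ n * (x * x - x) + (x ^+ n.+1 - x).
    by rewrite mulrBr mulrA -!exprSr addrA subrK.
  by apply: JD => //; apply: JM.
have jx : jacobson A x.
  apply: jacobson_closed => I tI nI; have [n In] := cvg0_exprS_ideal cv nI.
  exists (x - x ^+ n.+1); first by rewrite -opprB; apply: left_idealN lJ _.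
  by rewrite opprB addrC subrK.
have -> : e - a = - (b * (a * a - a) + x).
  rewrite (mulrBr b) mulrA -/e -ae /x mulrBr mulr1.
  by rewrite [in RHS]addrC addrA subrK opprB.
by apply: left_idealN lJ _; apply: JD => //; apply: JM.
Qed.

(* [g] is chosen maximal below [e] in [I]; if some [x * (e - g)], [x] in [I],
   were outside the Jacobson radical, a multiple [y] of it would not be
   topologically nilpotent, and the idempotent [k] of [y] would enlarge [g] to
   [g + (e - g) * k]. *)
Lemma jac_left_ideal_idempotent (I : set (jac_quot A)) e :
  idempotent_min A -> left_ideal I -> e * e = e ->
  (forall v, I v -> v * jac_proj e = v) ->
  exists g, [/\ g * g = g, e * g = g, g * e = g, I (jac_proj g) &
    forall v, I v -> v * jac_proj g = v].
Proof.
move=> minA lI ee Ie; have [I0 ID IM] := lI.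
(* Complements [1 - g] turn the minimal condition into the choice of a maximal [g]. *)
pose E := [set c | exists g, [/\ g * g = g, e * g = g /\ g * e = g,
                               I (jac_proj g) & c = 1 - g]].
have [||_ [g [gg [eg ge] Ig ->]] ming] := minA E.
- by exists (1 - 0), 0; rewrite !mulr0 !mul0r jac_proj0.
- by move=> _ [g [gg _ _ ->]]; apply: idempotentC.
exists g; split=> //; pose h := e - g.
have hh : h * h = h by rewrite /h mulrBr !mulrBl ee gg eg ge subrr subr0.
have gh : g * h = 0 by rewrite mulrBr ge gg subrr.
have hg : h * g = 0 by rewrite mulrBl eg gg subrr.
have eh : e * h = h by rewrite mulrBr ee eg.
have he : h * e = h by rewrite mulrBl ee ge.
have jh x : I (jac_proj x) -> jacobson A (x * h).
  move=> Ix; apply: left_inv_jacobson => r.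
  set y := r * (x * h); have yh : y * h = y by rewrite /y -!mulrA hh.
  have Iy : I (jac_proj y).
    rewrite jac_projM; apply: (IM); rewrite mulrBr jac_projB !jac_projM Ie //.
    by apply: ID => //; apply: left_idealN => //; apply: IM.
  have /quasi_pi_regular_eltP[b [yb byb cv]] := qprA y.
  pose k := b * y; have kk : k * k = k by rewrite /k mulrA byb.
  have kh : k * h = k by rewrite /k -mulrA yh.
  have hkhk : (h * k) * (h * k) = h * k.
    by rewrite mulrA -(mulrA h) kh -mulrA kk.
  have Ik : I (jac_proj k) by rewrite jac_projM; apply: (IM).
  have hk0 : h * k = 0.
    clearbody h k.
    suff /(congr1 (fun z => 1 - z)) : 1 - (g + h * k) = 1 - g.
      by rewrite !subKr -[RHS]addr0 => /addrI.
    have ghk : g * (h * k) = 0 by rewrite mulrA gh mul0r.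
    have hkg : (h * k) * g = 0 by rewrite -kh -!mulrA hg !mulr0.
    apply: ming.
    - exists (g + h * k); split=> //.
      + by rewrite mulrDr !mulrDl gg ghk hkg hkhk addr0 add0r.
      + split; first by rewrite mulrDr eg mulrA eh.
        by rewrite mulrDl ge -kh -!mulrA he.
      + by rewrite jac_projD; apply: ID => //; rewrite jac_projM; apply: (IM).
    - by rewrite mulrBl mul1r mulrBr mulr1 mulrDr gg ghk addr0 subrr subr0.
    - by rewrite mulrBr mulr1 mulrBl mul1r mulrDl gg hkg addr0 subrr subr0.
  (* As [k = k * h], [h * k = 0] forces [k = k * k = 0], which leaves only the topologically
     nilpotent part of [y]. *)
  have k0 : b * y = 0 by rewrite -/k -kk -{1}kh -mulrA hk0 mulr0.
  by apply: topnil_left_inv => //; rewrite k0 subr0 mulr1 in cv.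
move=> u Iu; have := jh (repr u); rewrite jac_proj_repr => /(_ Iu).
move=> /jac_proj_eq0; rewrite jac_projM jac_proj_repr jac_projB mulrBr Ie //.
by move/eqP; rewrite subr_eq0 => /eqP.
Qed.

(** Every left ideal of the quotient is generated by the image of an idempotent, whose left
    annihilator is a complement. In a descending chain, a minimal generating idempotent [e]
    stabilizes it: later terms have generators below [e], hence equal to [e]. *)
Lemma quasi_pi_regular_semiperfect : idempotent_min A -> semiperfect A.
Proof.
move=> minA; split; last exact: jac_lift_idempotent.
- move=> I lI.
  have [|u|g [gg _ _ Ig gI]] := jac_left_ideal_idempotent (e := 1) minA lI.
  + by rewrite mulr1.
  + by rewrite jac_proj1 mulr1.
  have [I0 ID IM] := lI.
  have ggq : jac_proj g * jac_proj g = jac_proj g by rewrite -jac_projM gg.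
  exists [set v | v * jac_proj g = 0]; split.
  + split=> [|u v /= u0 v0|a u /= u0].
    * exact: mul0r.
    * by rewrite mulrDl u0 v0 addr0.
    * by rewrite -mulrA u0 mulr0.
  + apply/seteqP; split=> [u [/gI uE u0]|_ ->]; first by rewrite /= -uE.
    by split=> //; apply: mul0r.
  + move=> a; exists (a * jac_proj g), (a - a * jac_proj g); split.
    * exact: IM.
    * by rewrite /= mulrBl -mulrA ggq subrr.
    * by rewrite addrC subrK.
- move=> L lL Ldec.
  have Lle m n : (m <= n)%N -> L n `<=` L m.
    move=> /subnK <-; elim: (n - m)%N => [//|k IH].
    by rewrite addSn; apply: subset_trans (Ldec _) IH.
  pose spans e n := L n (jac_proj e) /\ forall v, L n v -> v * jac_proj e = v.
  pose E := [set e | e * e = e /\ exists n, spans e n].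
  have [||e [ee [N [LNe eLN]]] mine] := minA E.
  + have [|u|g [gg _ _ Ig gI]] :=
      jac_left_ideal_idempotent (e := 1) minA (lL 0%N).
    * by rewrite mulr1.
    * by rewrite jac_proj1 mulr1.
    by exists g; split=> //; exists 0%N.
  + by move=> e [].
  exists N => n Nn; apply/seteqP; split; first exact: Lle.
  have [u|g [gg eg ge Ig gI]] := jac_left_ideal_idempotent minA (lL n) ee.
    by move=> /(Lle _ _ Nn)/eLN.
  have gE : g = e by apply: mine => //; split=> //; exists n.
  move=> u /eLN <-; rewrite -gE; by have [_ _ LM] := lL n; apply: LM.
Qed.

(** Let [I0] be an open ideal with minimal image in the quotient. For any open [I], [I] meets [I0]
    in an ideal with the same image, so each [x] in [I0] is congruent to an element of [I] modulo
    the radical; closedness gives the claim. *)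
Lemma jacobson_nbhs : artinian_ring (jac_quot A) -> nbhs (0 : A) (jacobson A).
Proof.
move=> artA.
pose F := [set K : set (jac_quot A) | exists I,
  [/\ two_sided_ideal I, nbhs (0 : A) I & K = [set jac_proj x | x in I]]].
have [||_ [I0 [tI0 nI0 ->]] minI] := artinian_min artA (F := F).
- exists [set jac_proj x | x in setT], setT; split=> //.
  exact: filterT.
- move=> _ [I [[[I0 ID IM] _] _ ->]].
  split=> [|_ _ [x Ix <-] [y Iy <-]|a _ [x Ix <-]].
  + by exists 0; rewrite ?jac_proj0.
  + by exists (x + y); [apply: ID|rewrite jac_projD].
  + by exists (repr a * x); [apply: IM|rewrite jac_projM jac_proj_repr].
apply: filterS (nI0) => x I0x; apply: jacobson_closed => I tI nI.
have : [set jac_proj x | x in I `&` I0] (jac_proj x).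
  have -> : [set jac_proj x | x in I `&` I0] = [set jac_proj x | x in I0].
    apply: minI; last by move=> _ [z [_ I0z] <-]; exists z.
    exists (I `&` I0); split=> [|| //]; last exact: filterI.
    move: tI tI0 => [[a1 a2 a3] a4] [[b1 b2 b3] b4].
    split; first split.
    - by split.
    - by move=> z w [? ?] [? ?]; split; [apply: a2|apply: b2].
    - by move=> z w [? ?]; split; [apply: a3|apply: b3].
    - by move=> z w [? ?]; split; [apply: a4|apply: b4].
  by exists x.
case=> z [Iz _] /jac_projP jzx; exists (x - z).
  by rewrite -opprB; apply: left_idealN jzx; apply: jacobson_left_ideal.
by rewrite opprB addrC subrK.
Qed.

End IdealSeparated.

(** * Descent to T-semi-invariant subrings *)

Lemma drazin_inverse_rmorph (A B : topologicalPzRingType)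
    (f : {rmorphism A -> B}) (a b : A) :
  continuous f -> drazin_inverse a b -> drazin_inverse (f a) (f b).
Proof.
move=> cf [ab bab cv]; split; rewrite -?rmorphM ?ab ?bab //.
rewrite -(rmorph0 f).
rewrite [X in X @ \oo --> _](_ : _ = f \o (fun n => (a * (1 - b * a)) ^+ n)).
  by apply: cvg_comp cv _; apply: cf.
by apply/funext => n /=; rewrite rmorphXn !rmorphM rmorphB rmorph1 rmorphM.
Qed.

Section Subring.
Variables (R : topologicalPzRingType) (R0 : subringClosed R).

Implicit Types x y : subring_of R0.

Lemma subring_val0 : val (0 : subring_of R0) = 0. Proof. by []. Qed.

Lemma subring_valD x y : val (x + y) = val x + val y. Proof. by []. Qed.

Lemma subring_valB x y : val (x - y) = val x - val y. Proof. by []. Qed.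

Lemma subring_valM x y : val (x * y) = val x * val y. Proof. by []. Qed.

Lemma subring_valX x n : val (x ^+ n) = val x ^+ n.
Proof. by elim: n => [|n IHn] //; rewrite !exprS -IHn. Qed.

Lemma subring_ideal_separated :
  ideal_separated R -> ideal_separated (subring_of R0).
Proof.
move=> sepR x xI; apply: val_inj; rewrite subring_val0.
apply: sepR => I [[I0 ID IM] IMr] nI.
apply: (xI [set y | I (val y)]).
  split; first split => //=.
  - by move=> y z Iy Iz; apply: ID.
  - by move=> y z Iz; apply: IM.
  - by move=> y z Iz; apply: IMr.
exact: (@subring_val_continuous R R0 0).
Qed.

Lemma subring_cvg0 (u : nat -> subring_of R0) :
  (fun n => val (u n)) @ \oo --> (0 : R) -> u @ \oo --> (0 : subring_of R0).
Proof.
move=> cu U; rewrite nbhsE => -[W [[V oV <-] V0] VU].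
have : nbhs (0 : R) V by apply: open_nbhs_nbhs.
by move/cu => -[m _ mV]; exists m => // n mn; apply/VU/(mV n mn).
Qed.

Lemma subring_idempotent_min :
  idempotent_min R -> idempotent_min (subring_of R0).
Proof.
move=> minR E [e0 Ee0] Eidem.
have [||_ [e Ee <-] mine] := minR [set val x | x in E].
- by exists (val e0), e0.
- by move=> _ [e Ee <-]; rewrite -subring_valM Eidem.
exists e => // g Eg eg ge; apply: val_inj; apply: mine; first by exists g.
- by rewrite -subring_valM eg.
- by rewrite -subring_valM ge.
Qed.

(** In [S], both [iota b] and [sigma (iota b)] are Drazin inverses of [iota a], so uniqueness makes
    them equal. *)
Lemma T_semi_invariant_drazin_inverse (a b : R) :
  T_semi_invariant R0 -> a \in R0 -> drazin_inverse a b -> b \in R0.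
Proof.
move=> [S [iota [Sigma [hS ltS [_ emb] cSigma fixR0]]]] aR0 dab.
have ciota : continuous iota.
  by apply/continuousP => V oV; apply/emb; exists V.
apply/fixR0 => sigma Ssigma.
have dS := drazin_inverse_rmorph ciota dab.
apply: (drazin_inverse_uniq (hausdorff_ideal_separated hS ltS) _ dS).
have := drazin_inverse_rmorph (cSigma _ Ssigma) dS.
by rewrite (proj1 (fixR0 a) aR0).
Qed.

Lemma T_semi_invariant_quasi_pi_regular :
  T_semi_invariant R0 -> quasi_pi_regular R -> quasi_pi_regular (subring_of R0).
Proof.
move=> tsi qprR a; apply/quasi_pi_regular_eltP.
have /quasi_pi_regular_eltP[b dab] := qprR (val a).
have bR0 := T_semi_invariant_drazin_inverse tsi (valP a) dab.
case: dab => ab bab cv.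
exists (Sub b bR0); split.
- by apply: val_inj; rewrite !subring_valM SubK.
- by apply: val_inj; rewrite !subring_valM SubK.
apply: subring_cvg0.
rewrite [X in X @ \oo --> _](_ : _ =
  fun n => (val a * (1 - b * val a)) ^+ n) //.
by apply/funext => n /=; rewrite subring_valX !(subring_valM, subring_valB).
Qed.

End Subring.

Theorem theorem5p10 (R : topologicalPzRingType) (R0 : subringClosed R)
  (R_hausdorff : hausdorff_space R)
  (R_LT : linearly_topologized R)
  (R_semiperfect : semiperfect R)
  (R_qpr : quasi_pi_regular R)
  (R0_Tsi : T_semi_invariant R0) :
  [/\ semiperfect (subring_of R0),
      quasi_pi_regular (subring_of R0) &
      exists n : nat, forall x : subring_of R0,
        ideal_exp (jacobson (subring_of R0)) n x -> jacobson R (val x)].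
Proof.
have sepR := hausdorff_ideal_separated R_hausdorff R_LT.
have [ssR artR _] := R_semiperfect.
have qpr0 := T_semi_invariant_quasi_pi_regular R0_Tsi R_qpr.
have sep0 := subring_ideal_separated (R0 := R0) sepR.
have min0 := subring_idempotent_min (R0 := R0) (artinian_idempotent_min artR).
split=> //; first exact: quasi_pi_regular_semiperfect.
pose J0 := jacobson (subring_of R0).
have [[_ _ JM] JMr] := jacobson_two_sided_ideal (subring_of R0).
pose N := [set jac_proj (val x) | x in J0].
have [||n kn] := nil_subsemigroup_nilpotent (N := N) artR ssR.
- move=> _ _ [x Jx <-] [y Jy <-]; exists (x * y); first exact: JM.
  by rewrite -jac_projM.
- move=> _ [x Jx <-]; have /quasi_pi_regular_eltP[b [xb bxb cv]] := qpr0 x.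
  (* The idempotent [b * x] lies in [J0], so it is zero and [x] is topologically nilpotent; openness
     of [jacobson R] then makes its image in the quotient nilpotent. *)
  have bx0 : b * x = 0.
    by apply: idempotent_jacobson_eq0; [rewrite mulrA bxb|apply: JM].
  rewrite bx0 subr0 mulr1 in cv.
  have nJ : nbhs (0 : subring_of R0) [set y | jacobson R (val y)].
    exact: (@subring_val_continuous R R0 0 _ (jacobson_nbhs sepR R_qpr artR)).
  have [k /= jk] := cvg0_exprS_ideal cv nJ.
  exists k.+1; rewrite -(rmorphXn (@jac_proj R)) -subring_valX.
  exact/jac_proj_eq0.
exists n => x xJn; apply/jac_proj_eq0.
(* The prefix [z] absorbs the left factor from [J0] at each step of the induction on [m]. *)
suff killJ m z (w : subring_of R0) : kill N m z -> ideal_exp J0 m w ->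
    z * jac_proj (val w) = 0.
  by rewrite -[LHS]mul1r; apply: killJ (kn 1) xJn.
elim: m z w => [|m IHm] z w /=; first by move=> ->; rewrite mul0r.
move=> kz [k [y [v [yv ->]]]].
elim/big_ind: _ => [|a b za zb|i _].
- by rewrite subring_val0 jac_proj0 mulr0.
- by rewrite subring_valD jac_projD mulrDr za zb addr0.
- have [Jy Jv] := yv i; rewrite subring_valM jac_projM mulrA.
  by apply: IHm Jv; apply: kz; exists (y i).
Qed.
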